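(* For any inputs of the problem (HOP), the branch-and-bound algorithm described in the context (Algorithm BB) terminates after finitely many iterations.
   Context: Data of the heated oil pipeline (HOP) problem. There are $N^S$ stations $j=1,\dots,N^S$; the pipe between stations $j$ and $j+1$ is divided into $N^P_j\ge 1$ segments $r=1,\dots,N^P_j$. The given constants are: $C_p,C_f,V_c,\rho,c,g$; efficiencies $\xi_j^{CP},\xi_j^{SP},\eta_j$; volume flows $Q_{jr}$ ($r\ge 0$); lengths $L_{jr}$; inner and outer diameters $D_{jr},d_{jr}$; heat transfer coefficients $K_{jr}$; elevation differences $\Delta Z_{jr}\in\mathbb R$; pump heads $H_j^{CP}$ and $\underline H_j^{SP}\le\overline H_j^{SP}$; pump numbers $N_j^{CP},N_j^{SP}\in\mathbb Z_{\ge0}$; temperatures $T_g^{P_{jr}},T_f^{P_{jr}}$; and the lower and upper bounds (underlined/overlined) on heads and temperatures appearing below. All constants related to price, efficiency, flow, length, diameter, head, temperature and friction are nonnegative, and those occurring in denominators, as well as $Q_{jr},D_{jr}$, are positive. Put $\alpha_{jr}=K_{jr}\pi d_{jr}/(\rho Q_{jr}c)$. $f(T,Q,D)$ is a given real-valued function (evaluated at positive temperatures $T$). The inlet head and temperature of station 1 are given: $\underline H_{in}^{S_1}=\overline H_{in}^{S_1}$, $\underline T_{in}^{S_1}=\overline T_{in}^{S_1}$. Standing assumption: for all fixed $Q>0$, $D>0$, $T\mapsto f(T,Q,D)$ is convex and strictly monotonically decreasing for $T>0$. Variables (a scheme $\Psi$): $x_j,y_j,\Delta H_j^{SP},\Delta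 T_j,H_{out}^{S_j},T_{out}^{S_j}$ ($1\le j\le N^S-1$); $H_{in}^{S_j},T_{in}^{S_j}$ ($1\le j\le N^S$); $H_{out}^{P_{jr}},T_{out}^{P_{jr}}$ ($0\le r\le N^P_j$) and $T_{ave}^{P_{jr}},F_{jr}$ ($1\le r\le N^P_j$), for $1\le j\le N^S-1$. Write $z=(x,y)$. Constraints (for $j=1,\dots,N^S-1$ and $r=1,\dots,N^P_j$ unless specified; $\underline z=(\underline x,\underline y)$, $\overline z=(\overline x,\overline y)$ are integer vectors): (a) $H_{out}^{P_{jr}}=H_{out}^{P_{j,r-1}}-F_{jr}-\Delta Z_{jr}$; (b) $F_{jr}=f(T_{ave}^{P_{jr}},Q_{jr},D_{jr})L_{jr}$; (c) $T_{out}^{P_{jr}}=T_g^{P_{jr}}+T_f^{P_{jr}}+[T_{out}^{P_{j,r-1}}-(T_g^{P_{jr}}+T_f^{P_{jr}})]e^{-\alpha_{jr}L_{jr}}$; (d) $T_{ave}^{P_{jr}}=\frac13T_{out}^{P_{j,r-1}}+\frac23T_{out}^{P_{jr}}$; (e) $H_{in}^{S_j}+x_jH_j^{CP}+\Delta H_j^{SP}\ge H_{out}^{S_j}$; (f) $y_j\underline H_j^{SP}\le\Delta H_j^{SP}\le y_j\overline H_j^{SP}$; (g) $T_{in}^{S_j}+\Delta T_j=T_{out}^{S_j}$, $\Delta T_j\ge0$; (h) $T_{out}^{P_{j0}}=T_{out}^{S_j}$, $T_{out}^{P_{jN^P_j}}=T_{in}^{S_{j+1}}$, $H_{out}^{P_{j0}}=H_{out}^{S_j}$,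 $H_{out}^{P_{jN^P_j}}=H_{in}^{S_{j+1}}$; (i) $\underline H_{in}^{S_j}\le H_{in}^{S_j}\le\overline H_{in}^{S_j}$ and $\underline T_{in}^{S_j}\le T_{in}^{S_j}\le\overline T_{in}^{S_j}$ for $j=1,\dots,N^S$; $\underline H_{out}^{S_j}\le H_{out}^{S_j}\le\overline H_{out}^{S_j}$ and $\underline T_{out}^{S_j}\le T_{out}^{S_j}\le\overline T_{out}^{S_j}$ for $j\le N^S-1$; $\underline H_{out}^{P_{jr}}\le H_{out}^{P_{jr}}\le\overline H_{out}^{P_{jr}}$ for $r=1,\dots,N^P_j-1$; (j) $x_j\in\{\underline x_j,\underline x_j+1,\dots,\overline x_j\}$, $y_j\in\{\underline y_j,\underline y_j+1,\dots,\overline y_j\}$; (k) $x_j\in[\underline x_j,\overline x_j]$, $y_j\in[\underline y_j,\overline y_j]$ (real); (l) $F_{jr}\ge f(T_{ave}^{P_{jr}},Q_{jr},D_{jr})L_{jr}$. Objective: $C(x,\Delta H^{SP},\Delta T)=\sum_{j=1}^{N^S-1}\big[C_p\rho Q_{j0}g\big(\frac{x_jH_j^{CP}}{\xi_j^{CP}}+\frac{\Delta H_j^{SP}}{\xi_j^{SP}}\big)+C_fc\rho Q_{j0}\frac{\Delta T_j}{\eta_jV_c}\big]$. (HOP($\underline z,\overline z$)): minimize $C$ subject to (a)-(j); (HOP) is the case $\underline z=0$, $\overline z=(N^{CP},N^{SP})$. (HOPnr1($\underline z,\overline z$)): minimize $C$ subject to (a)-(i),(k). (HOPnr2($\underline z,\overline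 z$)): minimize $C$ subject to (a),(c)-(i),(k),(l). A vector $s=(z,\Delta H^{SP},\Delta T,H_{out}^S)$ determines a unique scheme satisfying all equality constraints of (HOP), resp. (HOPnr1), and $s$ is feasible if that scheme satisfies all inequality and integrality constraints. For (HOPnr2) the same holds with $s=(z,\Delta H^{SP},\Delta T,H_{out}^S,F)$. Algorithm BB (all subproblems are solved exactly; each individual step counts as one finite step; $\min\emptyset=+\infty$). 1. Set $\underline z=0$, $\overline z=(N^{CP},N^{SP})$, $LB=GLB=-\infty$, $GUB=+\infty$, $\mathcal Q=\{(\underline z,\overline z,LB)\}$. 2. While $\mathcal Q\ne\emptyset$ and $GLB<GUB$: (i) Choose $q=(\underline z,\overline z,LB)\in\mathcal Q$ and remove it from $\mathcal Q$. (ii) Preprocess (HOPnr1($\underline z,\overline z$)): either it is reported infeasible (correctly), or the bounds on heads and temperatures are tightened for this node without changing the feasible region of (HOPnr1($\underline z,\overline z$)), so that for each $j\le N^S-1$ there is a feasible solution of (HOPnr1($\underline z,\overline z$)) whose $T_{out}^{S_j}$ equals the tightened bound $\overline T_{out}^{S_j}$. (iii) If $LB<GUB$ and (HOPnr1($\underline z,\overline z$)) is feasible: solve (HOPnr2($\underline z,\overline z$)) (with tightened bounds) to get a (local, hence global) minimizer $\check s=(\check z,\Delta\check H^{SP},\Delta\check T,\check H^S_{out},\check F)$ and set $LB=C(\check x,\Delta\check H^{SP},\Delta\check T)$; obtain a feasible solution $\hat s$ of (HOPnr1($\underline z,\overline z$)) with the same components $z,\Delta H^{SP},\Delta T$ as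 $\check s$; obtain from $\hat s$ a feasible solution $\tilde s$ of (HOP) by $\tilde x=\lceil\hat x\rceil$, $\tilde y=\lceil\hat y\rceil$, $\Delta\tilde T=\Delta\hat T$, $\tilde H_{out}^S=\hat H_{out}^S$, and $\Delta\tilde H_j^{SP}=\Delta\hat H_j^{SP}$ if $\tilde y_j\underline H_j^{SP}\le\Delta\hat H_j^{SP}\le\tilde y_j\overline H_j^{SP}$, $\Delta\tilde H_j^{SP}=\tilde y_j\underline H_j^{SP}$ otherwise. If $C(\tilde x,\Delta\tilde H^{SP},\Delta\tilde T)<GUB$, set $GUB$ to this value and $s^*=\tilde s$. If some $\check x_{j_0}\notin\mathbb Z$ (or $\check y_{j_0}\notin\mathbb Z$), let $Lz$ be $\overline z$ with entry $x_{j_0}$ (resp. $y_{j_0}$) replaced by $\lfloor\check x_{j_0}\rfloor$ (resp. $\lfloor\check y_{j_0}\rfloor$), let $Rz$ be $\underline z$ with that entry replaced by $\lceil\check x_{j_0}\rceil$ (resp. $\lceil\check y_{j_0}\rceil$), and add $(\underline z,Lz,LB)$ and $(Rz,\overline z,LB)$ to $\mathcal Q$. (iv) Set $GLB$ to the minimum of the values $LB$ over all elements of $\mathcal Q$. 3. If $GUB=+\infty$, return ''(HOP) is infeasible''; otherwise return $s^*$ and $GUB$. *)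

(* Defs.v *)
From HB Require Import structures.
From mathcomp Require Import all_boot all_order all_algebra finmap.
From mathcomp Require Import all_classical all_reals all_analysis.

Set Implicit Arguments.
Unset Strict Implicit.
Unset Printing Implicit Defensive.

Import Order.TTheory GRing.Theory Num.Theory.

Local Open Scope fset_scope.
Local Open Scope ring_scope.

(* Indexing.  n is the number of pipes, so there are n.+1 >= 1 stations.
   Pipes, and the n stations at their upstream ends, are indexed by 'I_n; all
   stations by 'I_n.+1 (0-based).  The segments of pipe j are the naturals
   1 <= r <= NP j, and r = 0 denotes the entrance of the pipe; values of the
   nat-indexed families outside these ranges are never used. *)

Definition upstream n (j : 'I_n) : 'I_n.+1 := widen_ord (leqnSn n) j.
Definition downstream n (j : 'I_n) : 'I_n.+1 := lift ord0 j.

(* The operational bounds, kept apart from the other data because the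
   algorithm tightens them node by node.  HPout_lo and HPout_up are used only
   strictly inside a pipe, at 1 <= r < NP j. *)
Record hop_bounds (R : realType) (n : nat) := HopBounds {
  HSin_lo : 'I_n.+1 -> R;      HSin_up : 'I_n.+1 -> R;
  TSin_lo : 'I_n.+1 -> R;      TSin_up : 'I_n.+1 -> R;
  HSout_lo : 'I_n -> R;        HSout_up : 'I_n -> R;
  TSout_lo : 'I_n -> R;        TSout_up : 'I_n -> R;
  HPout_lo : 'I_n -> nat -> R; HPout_up : 'I_n -> nat -> R
}.

Record hop_data (R : realType) (n : nat) := HopData {
  NP : 'I_n -> nat;
  Cp : R; Cf : R; Vc : R; rho : R; cheat : R; grav : R;
  xiCP : 'I_n -> R; xiSP : 'I_n -> R; eta : 'I_n -> R;
  Qflow : 'I_n -> nat -> R;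
  Lseg : 'I_n -> nat -> R;
  Din : 'I_n -> nat -> R;      (* inner diameter, written D *)
  dout : 'I_n -> nat -> R;     (* outer diameter, written d *)
  Kheat : 'I_n -> nat -> R;
  dZ : 'I_n -> nat -> R;
  HCP : 'I_n -> R; HSP_lo : 'I_n -> R; HSP_up : 'I_n -> R;
  NCP : 'I_n -> nat; NSP : 'I_n -> nat;
  Tg : 'I_n -> nat -> R; Tf : 'I_n -> nat -> R;
  fric : R -> R -> R -> R;     (* hydraulic friction f(T, Q, D) *)
  bnds : hop_bounds R n
}.

Definition segment R n (p : hop_data R n) (j : 'I_n) (r : nat) : bool :=
  (1 <= r <= NP p j)%N.

Record hop_assumptions (R : realType) (n : nat) (p : hop_data R n) : Prop := {
  NP_ge1 : forall j, (1 <= NP p j)%N;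
  prices_ge0 : [/\ 0 <= Cp p, 0 <= Cf p & 0 <= grav p];
  denoms_gt0 : [/\ 0 < Vc p, 0 < rho p & 0 < cheat p];
  effic_gt0 : forall j, [/\ 0 < xiCP p j, 0 < xiSP p j & 0 < eta p j];
  Qflow_gt0 : forall j r, (r <= NP p j)%N -> 0 < Qflow p j r;
  Din_gt0 : forall j r, segment p j r -> 0 < Din p j r;
  segment_ge0 : forall j r, segment p j r ->
    [/\ 0 <= Lseg p j r, 0 <= dout p j r, 0 <= Kheat p j r,
        0 <= Tg p j r & 0 <= Tf p j r];
  pumps_ge0 : forall j,
    [/\ 0 <= HCP p j, 0 <= HSP_lo p j & HSP_lo p j <= HSP_up p j];
  in_bounds_ge0 : forall i,
    [/\ 0 <= HSin_lo (bnds p) i, 0 <= HSin_up (bnds p) i,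
        0 <= TSin_lo (bnds p) i & 0 <= TSin_up (bnds p) i];
  out_bounds_ge0 : forall j,
    [/\ 0 <= HSout_lo (bnds p) j, 0 <= HSout_up (bnds p) j,
        0 <= TSout_lo (bnds p) j & 0 <= TSout_up (bnds p) j];
  pipe_bounds_ge0 : forall j r, (1 <= r < NP p j)%N ->
    0 <= HPout_lo (bnds p) j r /\ 0 <= HPout_up (bnds p) j r;
  inlet_head : HSin_lo (bnds p) ord0 = HSin_up (bnds p) ord0;
  inlet_temp : TSin_lo (bnds p) ord0 = TSin_up (bnds p) ord0;
  fric_convex : forall Q D, 0 < Q -> 0 < D ->
    convex_function ([set T | 0 < T]%classic : set R) (fun T => fric p T Q D);
  fric_decr : forall Q D, 0 < Q -> 0 < D ->
    forall T1 T2 : R, 0 < T1 -> T1 < T2 -> fric p T2 Q D < fric p T1 Q D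
}.

Definition alpha R n (p : hop_data R n) j r : R :=
  Kheat p j r * pi * dout p j r / (rho p * Qflow p j r * cheat p).

Record scheme (R : realType) (n : nat) := Scheme {
  xnum : 'I_n -> R; ynum : 'I_n -> R;   (* written x and y *)
  dHSP : 'I_n -> R; dT : 'I_n -> R;
  HSout : 'I_n -> R; TSout : 'I_n -> R;
  HSin : 'I_n.+1 -> R; TSin : 'I_n.+1 -> R;
  HPout : 'I_n -> nat -> R; TPout : 'I_n -> nat -> R;
  TPave : 'I_n -> nat -> R; Fric : 'I_n -> nat -> R
}.

Definition ivec n := {ffun 'I_n -> int}.
(* An integer vector z = (x, y). *)
Definition zvec n := (ivec n * ivec n)%type.

Section Problems.
Context (R : realType) (n : nat) (p : hop_data R n).
Implicit Types (s : scheme R n) (b : hop_bounds R n) (zl zu : zvec n).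

Definition head_drop s := forall j r, segment p j r ->
  HPout s j r = HPout s j r.-1 - Fric s j r - dZ p j r.

Definition friction_eq s := forall j r, segment p j r ->
  Fric s j r = fric p (TPave s j r) (Qflow p j r) (Din p j r) * Lseg p j r.

Definition friction_ge s := forall j r, segment p j r ->
  Fric s j r >= fric p (TPave s j r) (Qflow p j r) (Din p j r) * Lseg p j r.

Definition temp_drop s := forall j r, segment p j r ->
  TPout s j r = Tg p j r + Tf p j r
    + (TPout s j r.-1 - (Tg p j r + Tf p j r))
      * expR (- (alpha p j r * Lseg p j r)).

Definition temp_average s := forall j r, segment p j r ->
  TPave s j r = 3^-1 * TPout s j r.-1 + 2 / 3 * TPout s j r.

Definition station_head s := forall j,
  HSin s (upstream j) + xnum s j * HCP p j + dHSP s j >= HSout s j.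

Definition shifted_pumps s := forall j,
  ynum s j * HSP_lo p j <= dHSP s j <= ynum s j * HSP_up p j.

Definition station_temp s := forall j,
  TSin s (upstream j) + dT s j = TSout s j /\ 0 <= dT s j.

Definition coupling s := forall j,
  [/\ TPout s j 0%N = TSout s j,
      TPout s j (NP p j) = TSin s (downstream j),
      HPout s j 0%N = HSout s j &
      HPout s j (NP p j) = HSin s (downstream j)].

Definition within_bounds b s :=
  [/\ forall i, HSin_lo b i <= HSin s i <= HSin_up b i,
      forall i, TSin_lo b i <= TSin s i <= TSin_up b i,
      forall j, HSout_lo b j <= HSout s j <= HSout_up b j,
      forall j, TSout_lo b j <= TSout s j <= TSout_up b j &
      forall j r, (1 <= r < NP p j)%N ->
        HPout_lo b j r <= HPout s j r <= HPout_up b j r].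

Definition integer_box zl zu s := forall j,
  (exists2 m : int, zl.1 j <= m <= zu.1 j & xnum s j = m%:~R) /\
  (exists2 m : int, zl.2 j <= m <= zu.2 j & ynum s j = m%:~R).

Definition real_box zl zu s := forall j,
  (zl.1 j)%:~R <= xnum s j <= (zu.1 j)%:~R /\
  (zl.2 j)%:~R <= ynum s j <= (zu.2 j)%:~R.

(* The constraints shared by the three problems. *)
Definition common b s :=
  [/\ head_drop s, temp_drop s, temp_average s & station_head s] /\
  [/\ shifted_pumps s, station_temp s, coupling s & within_bounds b s].

(* Feasible solutions are represented by their full schemes: a vector s is
   feasible iff the scheme it determines satisfies all the constraints. *)
Definition HOP b zl zu s :=
  [/\ common b s, friction_eq s & integer_box zl zu s].

Definition HOPnr1 b zl zu s :=
  [/\ common b s, friction_eq s & real_box zl zu s].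

Definition HOPnr2 b zl zu s :=
  [/\ common b s, friction_ge s & real_box zl zu s].

Definition cost s : R := \sum_(j < n)
  (Cp p * rho p * Qflow p j 0%N * grav p
     * (xnum s j * HCP p j / xiCP p j + dHSP s j / xiSP p j)
   + Cf p * cheat p * rho p * Qflow p j 0%N * (dT s j / (eta p j * Vc p))).

Definition HOPnr2_minimizer b zl zu s :=
  HOPnr2 b zl zu s /\ forall s', HOPnr2 b zl zu s' -> cost s <= cost s'.

End Problems.

Section BranchAndBound.
Context (R : realType) (n : nat) (p : hop_data R n).
Implicit Types (s : scheme R n) (b : hop_bounds R n) (zl zu : zvec n).

(* An element (zl, zu, LB) of the queue. *)
Definition node : Type := (zvec n * zvec n * \bar R)%type.

Definition z_min : zvec n := ([ffun=> 0], [ffun=> 0]).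
Definition z_max : zvec n :=
  ([ffun j => (NCP p j)%:Z], [ffun j => (NSP p j)%:Z]).

Definition tighter b' b :=
  [/\ forall i, HSin_lo b i <= HSin_lo b' i /\ HSin_up b' i <= HSin_up b i,
      forall i, TSin_lo b i <= TSin_lo b' i /\ TSin_up b' i <= TSin_up b i,
      forall j, HSout_lo b j <= HSout_lo b' j /\ HSout_up b' j <= HSout_up b j,
      forall j, TSout_lo b j <= TSout_lo b' j /\ TSout_up b' j <= TSout_up b j &
      forall j r, (1 <= r < NP p j)%N ->
        HPout_lo b j r <= HPout_lo b' j r /\ HPout_up b' j r <= HPout_up b j r].

(* The possible answers of preprocessing: None reports infeasibility, Some b
   returns tightened bounds b. *)
Definition preprocessed zl zu (answer : option (hop_bounds R n)) : Prop :=
  match answer with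
  | None => ~ exists s, HOPnr1 p (bnds p) zl zu s
  | Some b =>
      [/\ tighter b (bnds p),
          forall s, HOPnr1 p b zl zu s <-> HOPnr1 p (bnds p) zl zu s &
          forall j, exists2 s, HOPnr1 p (bnds p) zl zu s
                             & TSout s j = TSout_up b j]
  end.

(* Rounding up x and y leaves Delta T and H_out^S, hence all the components
   they determine, unchanged. *)
Definition round_up s : scheme R n :=
  let ty j : R := (Num.ceil (ynum s j))%:~R in
  {| xnum := fun j => (Num.ceil (xnum s j))%:~R;
     ynum := ty;
     dHSP := fun j =>
       if ty j * HSP_lo p j <= dHSP s j <= ty j * HSP_up p j
       then dHSP s j else ty j * HSP_lo p j;
     dT := dT s; HSout := HSout s; TSout := TSout s;
     HSin := HSin s; TSin := TSin s;
     HPout := HPout s; TPout := TPout s; TPave := TPave s; Fric := Fric s |}.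

Definition set_entry (v : ivec n) (j0 : 'I_n) (m : int) : ivec n :=
  [ffun j => if j == j0 then m else v j].

(* The nodes that may be created from the box (zl, zu) when the minimizer of
   its relaxation is s; any fractional entry may be chosen. *)
Variant branching zl zu (LB : \bar R) s : {fset node} -> Prop :=
| Branch_none of (forall j, xnum s j \is a Num.int)
               & (forall j, ynum s j \is a Num.int) :
    branching zl zu LB s fset0
| Branch_x j of xnum s j \isn't a Num.int :
    branching zl zu LB s
      [fset (zl, (set_entry zu.1 j (Num.floor (xnum s j)), zu.2), LB);
            ((set_entry zl.1 j (Num.ceil (xnum s j)), zl.2), zu, LB)]
| Branch_y j of ynum s j \isn't a Num.int :
    branching zl zu LB s
      [fset (zl, (zu.1, set_entry zu.2 j (Num.floor (ynum s j))), LB);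
            ((zl.1, set_entry zl.2 j (Num.ceil (ynum s j))), zu, LB)].

(* processed zl zu LB GUB best new GUB' best': given the incumbent value GUB
   and incumbent best, handling the node (zl, zu, LB) may create the set of
   nodes new and update the incumbent to GUB', best'. *)
Variant processed zl zu (LB GUB : \bar R) (best : option (scheme R n)) :
  {fset node} -> \bar R -> option (scheme R n) -> Prop :=
| Discard answer of
    preprocessed zl zu answer &
    ~ ((LB < GUB)%E /\ exists s, HOPnr1 p (bnds p) zl zu s) :
    processed zl zu LB GUB best fset0 GUB best
| Expand b check_s hat_s new of
    preprocessed zl zu (Some b) &
    (LB < GUB)%E &
    (exists s, HOPnr1 p (bnds p) zl zu s) &
    HOPnr2_minimizer p b zl zu check_s &
    HOPnr1 p b zl zu hat_s &
    [/\ xnum hat_s = xnum check_s, ynum hat_s = ynum check_s,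
        dHSP hat_s = dHSP check_s & dT hat_s = dT check_s] &
    HOP p (bnds p) z_min z_max (round_up hat_s) &
    branching zl zu (cost p check_s)%:E check_s new :
    let value := (cost p (round_up hat_s))%:E in
    processed zl zu LB GUB best new
      (if (value < GUB)%E then value else GUB)
      (if (value < GUB)%E then Some (round_up hat_s) else best).

Record bb_state := BBState {
  queue : {fset node};
  glb : \bar R;
  gub : \bar R;
  incumbent : option (scheme R n)
}.

Definition bb_init : bb_state :=
  BBState [fset (z_min, z_max, -oo%E)] -oo%E +oo%E None.

Definition bb_guard (st : bb_state) : bool :=
  (queue st != fset0) && (glb st < gub st)%E.

Definition bb_iteration (st st' : bb_state) : Prop :=
  exists zl zu LB new,
    [/\ (zl, zu, LB) \in queue st,
        processed zl zu LB (gub st) (incumbent st)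
          new (gub st') (incumbent st'),
        queue st' = (queue st `\ (zl, zu, LB)) `|` new &
        glb st' = \big[Order.min/+oo%E]_(q <- queue st') q.2].

Variant bb_output :=
| Infeasible
| Optimal of option (scheme R n) & \bar R.

Definition bb_result (st : bb_state) : bb_output :=
  if gub st == +oo%E then Infeasible else Optimal (incumbent st) (gub st).

Variant bb_config :=
| Running of bb_state
| Returned of bb_output.

Variant bb_step (st : bb_state) : bb_config -> Prop :=
| Loop st' of bb_guard st & bb_iteration st st' : bb_step st (Running st')
| Stop of ~~ bb_guard st : bb_step st (Returned (bb_result st)).

(* One possible execution: every choice left open by the algorithm (node,
   tightened bounds, minimizer, feasible solution, branching entry) is
   arbitrary.  Nothing is required of run after the algorithm has returned. *)
Definition bb_execution (run : nat -> bb_config) : Prop :=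
  run 0%N = Running bb_init /\
  forall k st, run k = Running st -> bb_step st (run k.+1).

End BranchAndBound.

Arguments Infeasible {R n}.

(* Main.v *)
Require Import Defs.
From mathcomp Require Import all_boot all_order all_algebra finmap.
From mathcomp Require Import all_classical all_reals all_analysis.
From mathcomp Require Import zify.

(** A branching entry is fractional and lies between its integer bounds, so
    each of the two child boxes is strictly narrower (in total width) than its
    parent. Giving a box of width w the weight 3^w, an iteration deletes a node
    of weight 3^w and adds at most two nodes of weight at most 3^(w-1), so the
    total weight of the queue strictly decreases. *)

Set Implicit Arguments.
Unset Strict Implicit.
Unset Printing Implicit Defensive.

Import Order.TTheory GRing.Theory Num.Theory.

Local Open Scope fset_scope.

(** An element occurs in the union at most as often as in the concatenation. Equality can fail when
    [A] and [B] overlap, as when a new node is already queued. *)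
Lemma sum_fsetU_leq (T : choiceType) (A B : {fset T}) (F : T -> nat) :
  \sum_(i <- A `|` B) F i <= \sum_(i <- A) F i + \sum_(i <- B) F i.
Proof.
rewrite -big_cat; apply: sub_le_big_seq => //= [x y|i].
  exact: leq_addr.
rewrite count_cat !count_uniq_mem ?fset_uniq// in_fsetU.
by case: (i \in A); case: (i \in B).
Qed.

Lemma sum_fset2_leq (T : choiceType) (a b : T) (F : T -> nat) :
  \sum_(i <- [fset a; b]) F i <= F a + F b.
Proof. by rewrite (leq_trans (sum_fsetU_leq _ _ _))// !big_seq_fset1. Qed.

Lemma sum_ltn_at (I : finType) (j : I) (F G : I -> nat) :
  (forall i, i != j -> F i = G i) -> F j < G j -> \sum_i F i < \sum_i G i.
Proof. by move=> FG FGj; rewrite (bigD1 j)// [ltnRHS](bigD1 j)//= (eq_bigr G)// ltn_add2r. Qed.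

(* Empty intervals have width 0. *)
Definition width (l u : int) : nat := `|Num.max 0%R (u - l)%R|%N.

Definition box_width n (l u : ivec n) : nat := \sum_j width (l j) (u j).

(** As widths are truncated at 0, strict decrease requires the old interval to have positive width,
    whence [l j < u j]. *)
Lemma box_width_set_upper n (l u : ivec n) j (m : int) :
  (l j < u j)%R -> (m < u j)%R ->
  box_width l (set_entry u j m) < box_width l u.
Proof.
move=> lu mu; apply: (@sum_ltn_at _ j) => [i /negPf ij|]; rewrite !ffunE.
  by rewrite ij.
by rewrite eqxx /width; lia.
Qed.

Lemma box_width_set_lower n (l u : ivec n) j (m : int) :
  (l j < u j)%R -> (l j < m)%R ->
  box_width (set_entry l j m) u < box_width l u.
Proof.
move=> lu lm; apply: (@sum_ltn_at _ j) => [i /negPf ij|]; rewrite !ffunE.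
  by rewrite ij.
by rewrite eqxx /width; lia.
Qed.

(** A non-integer differs from both integer bounds, so both inequalities are strict and pass to the
    floor and the ceiling. *)
Lemma fractional_between (R : archiRealDomainType) (x : R) (l u : int) :
  (x \isn't a Num.int)%R -> (l%:~R <= x <= u%:~R)%R ->
  [/\ (l < u)%R, (Num.floor x < u)%R & (l < Num.ceil x)%R].
Proof.
move=> xN /andP[lx xu].
have {}lx : (l%:~R < x)%R.
  by rewrite lt_neqAle lx andbT; apply: contraNneq xN => <-; rewrite intr_int.
have {}xu : (x < u%:~R)%R.
  by rewrite lt_neqAle xu andbT; apply: contraNneq xN => ->; rewrite intr_int.
by rewrite floor_lt_int ceil_gt_int -(ltr_int R) (lt_trans lx xu).
Qed.

Definition weight (R : realType) n (q : node R n) : nat :=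
  3 ^ (box_width q.1.1.1 q.1.2.1 + box_width q.1.1.2 q.1.2.2).

Lemma weight_gt0 (R : realType) n (q : node R n) : 0 < weight q.
Proof. by rewrite expn_gt0. Qed.

(** Each term is at most a third of [3 ^ c]; base 2 would allow equality. *)
Lemma expn3_halves (a b c : nat) : a < c -> b < c -> 3 ^ a + 3 ^ b < 3 ^ c.
Proof.
case: c => // c; rewrite !ltnS => ac bc.
have := leq_pexp2l (isT : 0 < 3) ac; have := leq_pexp2l (isT : 0 < 3) bc.
by have := expn_gt0 3 c; rewrite expnS; lia.
Qed.

(** The children carry [LB'], the value recomputed at the parent, whose own entry still has [LB]. *)
Lemma branching_weight (R : realType) n (zl zu : zvec n) (LB LB' : \bar R) s
    new : real_box zl zu s -> branching zl zu LB' s new ->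
  \sum_(q <- new) weight q < weight (zl, zu, LB).
Proof.
move=> box; case=> [_ _|j xN|j yN].
- by rewrite big_seq_fset0 weight_gt0.
- have [/(fractional_between xN)[lu fu lc] _] := box j.
  apply: (leq_ltn_trans (sum_fset2_leq _ _ _)); apply: expn3_halves => /=.
    by rewrite ltn_add2r box_width_set_upper.
  by rewrite ltn_add2r box_width_set_lower.
- have [_ /(fractional_between yN)[lu fu lc]] := box j.
  apply: (leq_ltn_trans (sum_fset2_leq _ _ _)); apply: expn3_halves => /=.
    by rewrite ltn_add2l box_width_set_upper.
  by rewrite ltn_add2l box_width_set_lower.
Qed.

Lemma processed_weight (R : realType) n (p : hop_data R n) zl zu LB GUB best
    new GUB' best' : processed p zl zu LB GUB best new GUB' best' ->
  \sum_(q <- new) weight q < weight (zl, zu, LB).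
Proof.
(* The minimizer is feasible for the relaxation, hence lies in the real box of the node. *)
case=> [*|b s ? ? _ _ _ [[_ _ box] _] _ _ _ br].
  by rewrite big_seq_fset0 weight_gt0.
exact: branching_weight br.
Qed.

Definition queue_weight (R : realType) n (st : bb_state R n) : nat :=
  \sum_(q <- queue st) weight q.

Lemma bb_iteration_weight (R : realType) n (p : hop_data R n) st st' :
  bb_iteration p st st' -> queue_weight st' < queue_weight st.
Proof.
move=> [zl [zu [LB [new [qst proc queue' _]]]]].
rewrite /queue_weight queue' (leq_ltn_trans (sum_fsetU_leq _ _ _))//.
by rewrite (big_fsetD1 _ qst) addnC ltn_add2r (processed_weight proc).
Qed.

Theorem theorem2 (R : realType) (n : nat) (p : hop_data R n)
    (hp : hop_assumptions p) (run : nat -> bb_config R n)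
    (hrun : bb_execution p run) :
  exists (k : nat) (out : bb_output R n), run k = Returned out.
Proof.
have [run0 runS] := hrun.
(* Induction on a strict bound [m] for the queue weight, from an arbitrary running step [k]. *)
have returns : forall m k st, queue_weight st < m -> run k = Running st ->
    exists k' out, run k' = Returned out.
  elim=> // m IHm k st st_m runk.
  case E: _ / (runS _ _ runk) => [st' _ it|_]; last by exists k.+1, (bb_result st).
  apply: (IHm k.+1 st') => //.
  exact: leq_trans (bb_iteration_weight it) st_m.
exact: returns _ _ _ (ltnSn _) run0.
Qed.
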